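(* Let $0\le r<1$, $0<\vartheta<1$, and let $d,n\in\mathbb{N}$ (with $d,n\ge 1$) satisfy $$n<\vartheta 2^{d}.$$ Then $P_1(d,r,n)>1-\vartheta$.
   Context: $B_d=\{X\in\mathbb{R}^d:\ \|X\|\le 1\}$ is the Euclidean unit ball centered at the origin, and $rB_d$ is the ball of radius $r$ centered at the origin. $M_n=\{X_1,\ldots,X_n\}$ is a set of $n$ points chosen randomly and independently according to the uniform distribution (normalized Lebesgue measure) on the spherical layer $B_d\setminus rB_d$. A point $X\in\mathbb{R}^d$ is linearly separable from a set $M\subset\mathbb{R}^d$ if there exists $A_X\in\mathbb{R}^d$ such that $(A_X,X)>(A_X,Y)$ for all $Y\in M$, where $(\cdot,\cdot)$ is the standard inner product. $P_1(d,r,n)$ denotes the probability that a random point, chosen according to the uniform distribution on $B_d\setminus rB_d$ (independently of $M_n$), is linearly separable from $M_n$. *)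

(* Defs.v *)
From HB Require Import structures.
From mathcomp Require Import all_boot all_order all_algebra.
From mathcomp Require Import all_classical all_reals all_analysis.
Set Implicit Arguments.
Unset Strict Implicit.
Unset Printing Implicit Defensive.
Import Order.TTheory GRing.Theory Num.Theory.
Local Open Scope classical_set_scope.
Local Open Scope ring_scope.

(* The n-fold product of a measure [mu] with itself, on the product
   sigma-algebra that the library puts on [n.-tuple T]: for n = 0 the unit mass
   on the empty tuple, and for n.+1 the image of [mu \x mu^n] under the
   identification of (x, t) with x :: t. *)
Fixpoint tuple_measure {R : realType} {d : measure_display}
    {T : measurableType d} (mu : set T -> \bar R) (n : nat) :
    set (n.-tuple T) -> \bar R :=
  match n return set (n.-tuple T) -> \bar R with
  | 0 => dirac [tuple]
  | m.+1 => pushforward (mu \x @tuple_measure R d T mu m)%E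
              (fun p : T * m.-tuple T => [tuple of p.1 :: p.2])
  end.
Arguments tuple_measure {R d T} mu n _.

(* The space R^d, with the Borel sigma-algebra. *)
Notation point R d := (d.-tuple (measurableTypeR R)).

Definition lebesgue_Rd {R : realType} {d : nat} : set (point R d) -> \bar R :=
  tuple_measure (@lebesgue_measure R) d.

Definition dotp {R : realType} {d : nat} (x y : point R d) : R :=
  \sum_(i < d) tnth x i * tnth y i.

Definition enorm {R : realType} {d : nat} (x : point R d) : R :=
  Num.sqrt (dotp x x).

Definition eball {R : realType} {d : nat} (r : R) : set (point R d) :=
  [set x | enorm x <= r].

Definition layer {R : realType} {d : nat} (r : R) : set (point R d) :=
  eball 1 `\` eball r.

Definition layer_uniform {R : realType} {d : nat} (r : R) :
    set (point R d) -> \bar R :=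
  fun A => (lebesgue_Rd (A `&` layer r) *
            ((fine (lebesgue_Rd (layer r : set (point R d))))^-1)%:E)%E.

Definition linearly_separable {R : realType} {d : nat}
    (x : point R d) (M : set (point R d)) : Prop :=
  exists a : point R d, forall y, M y -> dotp a y < dotp a x.

(* A sample point (s, x) consists of the sequence s = (X_1, ..., X_n) and of the
   additional point x; its law is the (n + 1)-fold product of the uniform
   distribution on the layer. *)
Definition P1 {R : realType} (d : nat) (r : R) (n : nat) : \bar R :=
  (tuple_measure (@layer_uniform R d r) n \x @layer_uniform R d r)%E
  [set p : n.-tuple (point R d) * point R d |
    linearly_separable p.2 [set tnth p.1 i | i in [set: 'I_n]]].

(* Main.v *)
(* If a point x lies outside the ball with diameter [0, y] then (x, y) < (x, x);
   hence x is separated from y_1, ..., y_n by the functional (x, .) as soon as it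
   avoids the n balls D_i with diameters [0, y_i].  For |y_i| <= 1 each D_i covers
   at most a fraction 2^-d of the layer: if |y_i| > r, the ball with diameter
   [0, (r / |y_i|) y_i] lies both in D_i and in rB_d, so D_i \ rB_d has volume at
   most (|y_i|^d - r^d) / 2^d times that of the unit ball, whereas the layer has
   volume (1 - r^d) times it.  The conditional probability of nonseparability given
   the sample is therefore at most n / 2^d < theta. *)
Require Import Defs.
From HB Require Import structures.
From mathcomp Require Import all_boot all_order all_algebra.
From mathcomp Require Import all_classical all_reals all_analysis.
From mathcomp Require Import measurable_realfun ring lra.
(* Restores the notation [point R d], shadowed by [point] of pointed types. *)
Import Defs.
Set Implicit Arguments.
Unset Strict Implicit.
Unset Printing Implicit Defensive.
Import Order.TTheory GRing.Theory Num.Theory.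
Local Open Scope classical_set_scope.
Local Open Scope ring_scope.

(** * Monotonicity of the integral *)

Section monotone_on_all_sets.
Local Open Scope ereal_scope.
Context {R : realType}.

(* No measurability is required: the integral is a supremum over the simple
   functions below the integrand. *)
Lemma ge0_le_integralT d (T : measurableType d)
    (mu : {measure set T -> \bar R}) (f g : T -> \bar R) :
  (forall x, 0 <= f x) -> (forall x, f x <= g x) ->
  \int[mu]_x f x <= \int[mu]_x g x.
Proof.
move=> f0 fg; have g0 x : 0 <= g x by exact: le_trans (fg x).
rewrite !ge0_integralTE//; apply: le_ereal_sup => _ [h /= hf <-].
by exists h => //= x; exact: le_trans (fg x).
Qed.

End monotone_on_all_sets.

(** * Powers of a sigma-finite measure are sigma-finite measures *)

Section tuple_cons.
Context {d} {T : measurableType d} (n : nat).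

Definition tuple_cons (p : T * n.-tuple T) : n.+1.-tuple T :=
  [tuple of p.1 :: p.2].

Lemma measurable_tuple_cons : measurable_fun setT tuple_cons.
Proof. exact: measurable_cons. Qed.

End tuple_cons.

Section tuple_measure_structure.
Local Open Scope ereal_scope.
Context {R : realType} {d} {T : measurableType d}.
Variable mu : {sigma_finite_measure set T -> \bar R}.

Section tuple_cons_measure.
Context {n : nat} (m : {sigma_finite_measure set (n.-tuple T) -> \bar R}).

(** One step of [tuple_measure], with an arbitrary sigma-finite [m] in place of the [n]-th power, so
    that measure structures can be attached to it before the induction. *)
Definition cons_measure : set (n.+1.-tuple T) -> \bar R :=
  pushforward (mu \x m) (@tuple_cons _ T n).

HB.instance Definition _ := Measure.copy cons_measure
  (measure_function_pushforward__canonical__measure_function_Measure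
    (mu \x m) (@measurable_tuple_cons _ T n)).

Lemma preimage_tuple_cons_box (A : set T) (B : set (n.-tuple T)) :
  @tuple_cons _ T n @^-1` [set t | A (thead t) /\ B [tuple of behead t]] =
  A `*` B.
Proof.
apply/funext => -[x t] /=; rewrite theadE; congr (_ /\ B _).
exact: val_inj.
Qed.

Lemma measurable_tuple_box (A : set T) (B : set (n.-tuple T)) :
  measurable A -> measurable B ->
  measurable [set t : n.+1.-tuple T | A (thead t) /\ B [tuple of behead t]].
Proof.
move=> mA mB; apply: measurableI; rewrite -[X in measurable X]setTI.
  exact: measurable_tnth.
exact: measurable_behead.
Qed.

Lemma cons_measure_box (A : set T) (B : set (n.-tuple T)) :
  measurable A -> measurable B ->
  cons_measure [set t | A (thead t) /\ B [tuple of behead t]] = mu A * m B.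
Proof.
move=> mA mB; rewrite /cons_measure /pushforward preimage_tuple_cons_box.
exact: product_measure1E.
Qed.

Lemma sigma_finite_cons_measure : sigma_finite setT cons_measure.
Proof.
have /sigma_finiteP[F [TF ndF Foo]] := sigma_finiteT mu.
have /sigma_finiteP[G [TG ndG Goo]] := sigma_finiteT m.
exists (fun k => [set t | F k (thead t) /\ G k [tuple of behead t]]).
  apply/seteqP; split=> // t _.
  have [k _ Fk] : (\bigcup_k F k) (thead t) by rewrite -TF.
  have [l _ Gl] : (\bigcup_k G k) [tuple of behead t] by rewrite -TG.
  (* Both exhaustions are increasing, so the larger index serves both factors. *)
  exists (maxn k l) => //; split.
    by move: Fk; exact/subsetPset/ndF/leq_maxl.
  by move: Gl; exact/subsetPset/ndG/leq_maxr.
move=> k; have [mF Fk] := Foo k; have [mG Gk] := Goo k; split.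
  exact: measurable_tuple_box.
by rewrite cons_measure_box// lte_mul_pinfty// ge0_fin_numE.
Qed.

HB.instance Definition _ := Measure_isSigmaFinite.Build _ _ _ cons_measure
  sigma_finite_cons_measure.

End tuple_cons_measure.

(** The induction carries a structured measure [m], because forming the product with the previous
    power relies on its sigma-finiteness; the axioms are then transported to the bare recursion. *)
Lemma tuple_measure_is_measure n :
  exists m : {sigma_finite_measure set (n.-tuple T) -> \bar R},
    tuple_measure mu n = m.
Proof.
elim: n => [|n [m mE]]; first by exists (dirac [tuple]).
by exists (cons_measure m); rewrite /= mE.
Qed.

Let tuple_measure0 n : tuple_measure mu n set0 = 0.
Proof. by have [m ->] := tuple_measure_is_measure n. Qed.

Let tuple_measure_ge0 n A : 0 <= tuple_measure mu n A.
Proof. by have [m ->] := tuple_measure_is_measure n. Qed.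

Let tuple_measure_sigma_additive n : semi_sigma_additive (tuple_measure mu n).
Proof.
by have [m ->] := tuple_measure_is_measure n; exact: measure_semi_sigma_additive.
Qed.

HB.instance Definition _ n := isMeasure.Build _ _ _ (tuple_measure mu n)
  (tuple_measure0 n) (@tuple_measure_ge0 n) (@tuple_measure_sigma_additive n).

Let sigma_finite_tuple_measure n : sigma_finite setT (tuple_measure mu n).
Proof. by have [m ->] := tuple_measure_is_measure n; exact: sigma_finiteT. Qed.

HB.instance Definition _ n := Measure_isSigmaFinite.Build _ _ _
  (tuple_measure mu n) (sigma_finite_tuple_measure n).

End tuple_measure_structure.

(** * Slices, monotonicity and coordinatewise maps for power measures *)

Section tuple_measure_theory.
Local Open Scope ereal_scope.
Context {R : realType} {d} {T : measurableType d}.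
Variable mu : {sigma_finite_measure set T -> \bar R}.

(** The product measure is by definition the integral of the measures of the slices, whence the
    formula for arbitrary [A]. *)
Lemma tuple_measureS n (A : set (n.+1.-tuple T)) :
  tuple_measure mu n.+1 A =
  \int[mu]_x tuple_measure mu n [set t | A (tuple_cons (x, t))].
Proof.
rewrite [LHS]/= /pushforward /product_measure1; apply: eq_integral => x _ /=.
by rewrite xsectionE.
Qed.

Lemma tuple_cons_map n (f : 'I_n.+1 -> T -> T) (x : T) (t : n.-tuple T) :
  [tuple f i (tnth (tuple_cons (x, t)) i) | i < n.+1] =
  tuple_cons (f ord0 x, [tuple f (lift ord0 i) (tnth t i) | i < n]).
Proof.
apply: eq_from_tnth => i; rewrite tnth_mktuple.
case: (unliftP ord0 i) => [j ->|->]; last by rewrite !tnth0.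
by rewrite !tnthS tnth_mktuple.
Qed.

Lemma measurable_all_in n (A : set T) : measurable A ->
  measurable [set t : n.-tuple T | forall i, A (tnth t i)].
Proof.
move=> mA; rewrite (_ : [set _ | _] = \bigcap_(i : 'I_n) ((@tnth _ T)^~ i @^-1` A)).
  apply: fin_bigcap_measurable => // i _.
  rewrite -[X in measurable X]setTI; exact: measurable_tnth.
by apply/seteqP; split=> [t At i _|t At i]; exact: At.
Qed.

Lemma tuple_measure_all_in n (A : set T) : measurable A ->
  tuple_measure mu n [set t | forall i, A (tnth t i)] = mu A ^+ n.
Proof.
move=> mA; elim: n => [|n IHn].
  by rewrite expe0 /= diracE mem_set// => -[].
rewrite tuple_measureS expeS -IHn.
(* The slice at [x] is the same event for [n]-tuples if [x] lies in [A], and empty otherwise. *)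
rewrite (eq_integral (fun x =>
    tuple_measure mu n [set t | forall i, A (tnth t i)] * (\1_A x)%:E)).
  rewrite ge0_integralZl//=; last exact/measurable_EFinP.
  by rewrite integral_indic// setIT muleC.
move=> x _; rewrite indicE.
have [xA|xA] := boolP (x \in A); rewrite ?mule1 ?mule0.
  congr (tuple_measure mu n); apply/seteqP; split=> t /= At i.
    by have := At (lift ord0 i); rewrite tnthS.
  case: (unliftP ord0 i) => [j ->|->]; first by rewrite tnthS.
  by rewrite tnth0; exact/set_mem.
rewrite -[RHS](measure0 (tuple_measure mu n)).
congr (tuple_measure mu n); rewrite -subset0 => t /= /(_ ord0).
by rewrite tnth0 => /mem_set; rewrite (negbTE xA).
Qed.

Lemma le_tuple_measure n :
  {homo (mu : set T -> \bar R) : A B / A `<=` B >-> A <= B} ->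
  {homo tuple_measure mu n : A B / A `<=` B >-> A <= B}.
Proof.
move=> mu_le; elim: n => [|n IHn] A B AB.
  rewrite /= !diracE lee_fin ler_nat.
  by have [/set_mem/AB/mem_set ->|] := boolP (_ \in A).
rewrite !tuple_measureS; apply: ge0_le_integralT => // x.
by apply: IHn => t; exact: AB.
Qed.

(** Change of variables one coordinate at a time: the induction hypothesis treats the tail of each
    slice, and the first coordinate contributes the remaining factor [k]. *)
Lemma tuple_measure_map n (k : {nonneg R}) (f : 'I_n -> T -> T)
    (A : set (n.-tuple T)) :
  (forall i, measurable_fun setT (f i)) ->
  (forall i B, measurable B -> mu (f i @^-1` B) = k%:num%:E * mu B) ->
  measurable A ->
  tuple_measure mu n [set t | A [tuple f i (tnth t i) | i < n]] =
  (k%:num ^+ n)%:E * tuple_measure mu n A.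
Proof.
move=> + + mA; elim: n f A mA => [|n IHn] f A mA mf muf.
  rewrite expr0 mul1e; congr (tuple_measure mu 0).
  by apply/funext => t; rewrite /= (tuple0 t) [X in A X]tuple0.
pose phi x := tuple_measure mu n [set t | A (tuple_cons (x, t))].
have mphi : measurable_fun setT phi.
  rewrite (_ : phi = tuple_measure mu n \o xsection (@tuple_cons _ T n @^-1` A)).
    apply: measurable_fun_xsection.
    by rewrite -[X in measurable X]setTI; exact: measurable_tuple_cons.
  by apply/funext => x /=; rewrite xsectionE.
rewrite tuple_measureS (eq_integral (fun x => (k%:num ^+ n)%:E * phi (f ord0 x))).
  rewrite ge0_integralZl//; last exact: (measurableT_comp mphi (mf ord0)).
  rewrite -[X in _ * X = _](@ge0_integral_pushforward _ _ _ _ R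
    (f ord0) (mf ord0) mu setT phi)//.
  (* The image of [mu] under [f ord0] agrees with [k] times [mu] on measurable sets. *)
  rewrite (@eq_measure_integral _ _ _ _ (mscale k mu)); last first.
    by move=> B mB _; rewrite /= /pushforward muf.
  by rewrite ge0_integral_mscale// tuple_measureS muleA -EFinM -exprSr.
move=> x _; rewrite -(IHn (fun i => f (lift ord0 i))) => [|||i B mB].
- by congr (tuple_measure mu n); apply/funext => t /=; rewrite tuple_cons_map.
- rewrite (_ : [set _ | _] = xsection (@tuple_cons _ T n @^-1` A) (f ord0 x)).
    apply: measurable_xsection.
    by rewrite -[X in measurable X]setTI; exact: measurable_tuple_cons.
  by rewrite xsectionE.
- by move=> i; exact: mf.
- exact: muf.
Qed.

End tuple_measure_theory.

(** * Lebesgue measure on R^d under affine maps *)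

Section lebesgue_Rd_theory.
Context {R : realType}.

Lemma measurable_affine (c b : R) :
  measurable_fun setT (fun x : measurableTypeR R => c * x - b : measurableTypeR R).
Proof. by apply: measurable_funB => //; exact: measurable_funM. Qed.

(** By uniqueness of Lebesgue measure: [m], which is [c] times its image under the affine map, gives
    every half-open interval its length. *)
Lemma lebesgue_measure_affine (k : {nonneg R}) (c b : R)
    (A : set (measurableTypeR R)) :
  0 < c -> k%:num = c^-1 -> measurable A ->
  (lebesgue_measure ((fun x => c * x - b)%R @^-1` A) =
   k%:num%:E * lebesgue_measure A)%E.
Proof.
move=> c0 kE mA; have c_ge0 := ltW c0.
pose m := mscale (NngNum c_ge0)
  (measure_function_pushforward__canonical__measure_function_Measure
    (@lebesgue_measure R) (measurable_affine c b)).
rewrite [X in _ = (_ * X)%E](@lebesgue_measure_unique R m) => [|_ [[a a']] _ <-|//].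
  change (m A) with (c%:E * lebesgue_measure ((fun x : R => c * x - b)%R @^-1` A))%E.
  rewrite muleA kE -EFinM mulVf ?mul1e//.
  by rewrite gt_eqF.
(* As [c] is positive, the preimage of a half-open interval is the half-open interval with the
   preimages of its endpoints. *)
transitivity (c%:E * lebesgue_measure `]((a + b) / c)%R, ((a' + b) / c)%R]%classic)%E;
  last first.
  congr (_ * lebesgue_measure _)%E; apply/seteqP; split=> x /=;
    by rewrite !in_itv/= ltrBrDr lerBlDr ltr_pdivrMr// ler_pdivlMr// [c * x]mulrC.
rewrite !lebesgue_measure_itv/= !lte_fin ltr_pM2r ?invr_gt0// ltrD2r.
case: ifPn => _; last by rewrite mule0.
rewrite -!EFinD -EFinM; congr (_%:E); field.
by rewrite gt_eqF.
Qed.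

Context {d : nat}.

HB.instance Definition _ := SigmaFiniteMeasure.copy (@lebesgue_Rd R d)
  (tuple_measure (@lebesgue_measure R) d).

Lemma lebesgue_Rd_affine (c : R) (b : 'I_d -> R) (A : set (point R d)) :
  0 < c -> measurable A ->
  (lebesgue_Rd [set x : point R d | A [tuple c * tnth x i - b i | i < d]%R] =
   ((c^-1) ^+ d)%:E * lebesgue_Rd A)%E.
Proof.
move=> c0 mA; have ci0 : 0 <= c^-1 by rewrite invr_ge0 ltW.
pose k := NngNum ci0; rewrite -[c^-1]/(k%:num).
apply: (@tuple_measure_map R _ _ (@lebesgue_measure R) d k
  (fun i (x : measurableTypeR R) => c * x - b i : measurableTypeR R)) => //.
  by move=> i; exact: measurable_affine.
by move=> i B mB; exact: lebesgue_measure_affine.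
Qed.

(** On the line, Lebesgue measure is monotone on all sets, being given by an outer measure; its
    powers inherit this. *)
Lemma le_lebesgue_Rd :
  {homo (@lebesgue_Rd R d) : A B / A `<=` B >-> (A <= B)%E}.
Proof.
apply: le_tuple_measure => A B AB.
exact: le_outer_measure.
Qed.

End lebesgue_Rd_theory.

(** * Scalar products and balls with diameter [0, y] *)

Section diameter_balls.
Context {R : realType} {d : nat}.
Implicit Types (x y z : point R d) (r s t : R).

Definition scalep t y : point R d := [tuple t * tnth y i | i < d].

(* The ball with diameter [0, y]: by Thales, |2x - y| <= |y| iff (x, x) <= (y, x). *)
Definition diam_ball y : set (point R d) := [set x | dotp x x <= dotp y x].

Lemma dotpC x y : dotp x y = dotp y x.
Proof. by apply: eq_bigr => i _; rewrite mulrC. Qed.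

Lemma dotp_ge0 x : 0 <= dotp x x.
Proof. by apply: sumr_ge0 => i _; rewrite -expr2 sqr_ge0. Qed.

Lemma dotp_eq0 x : dotp x x = 0 -> forall i, tnth x i = 0.
Proof.
move=> xx0 i; have /psumr_eq0P/(_ i isT)/eqP := xx0.
rewrite -expr2 sqrf_eq0 => xi; apply/eqP/xi => j _; exact: sqr_ge0.
Qed.

Lemma dotp0 x y : dotp x x = 0 -> dotp x y = 0.
Proof. by move=> xx0; rewrite /dotp big1// => i _; rewrite dotp_eq0// mul0r. Qed.

Lemma dotp_scale t x y : dotp (scalep t x) y = t * dotp x y.
Proof.
by rewrite /dotp mulr_sumr; apply: eq_bigr => i _; rewrite tnth_mktuple mulrA.
Qed.

Lemma dotp_affine (c : R) (b x : point R d) :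
  let u := [tuple c * tnth x i - tnth b i | i < d] in
  dotp u u = c ^+ 2 * dotp x x - 2 * c * dotp b x + dotp b b.
Proof.
rewrite /dotp !mulr_sumr -sumrB -big_split/=.
by apply: eq_bigr => i _; rewrite tnth_mktuple; ring.
Qed.

Lemma enorm_sqr x : enorm x ^+ 2 = dotp x x.
Proof. by rewrite sqr_sqrtr// dotp_ge0. Qed.

Lemma enorm_ge0 x : 0 <= enorm x. Proof. exact: sqrtr_ge0. Qed.

Lemma eballE r : 0 <= r -> eball r = [set x : point R d | dotp x x <= r ^+ 2].
Proof.
move=> r0; apply/seteqP; split=> x;
  by rewrite /eball /= -enorm_sqr ler_pXn2r ?nnegrE ?enorm_ge0.
Qed.

Lemma subset_eball r s : r <= s -> eball r `<=` (eball s : set (point R d)).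
Proof. by move=> rs x; rewrite /eball /= => /le_trans; exact. Qed.

(** Expanding [|x - y|^2 >= 0] and using [(x, x) <= (y, x)] yields [(x, x) <= (y, y)]. *)
Lemma diam_ball_sub_eball y : diam_ball y `<=` eball (enorm y).
Proof.
move=> x; rewrite eballE ?enorm_ge0//= enorm_sqr /diam_ball /= => xy.
have := dotp_ge0 [tuple 1 * tnth x i - tnth y i | i < d].
by rewrite (dotp_affine 1 y x) expr1n; lra.
Qed.

(** Unless [x] is the origin, [(x, x) <= t (y, x)] forces [(y, x) > 0], and then
    [t (y, x) <= (y, x)]. *)
Lemma diam_ball_scale t y : 0 <= t <= 1 -> diam_ball (scalep t y) `<=` diam_ball y.
Proof.
move=> /andP[t0 t1] x; rewrite /diam_ball /= dotp_scale => txy.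
have [xx0|xx0] := eqVneq (dotp x x) 0; first by rewrite xx0 [dotp y x]dotpC dotp0.
have xx_gt0 : 0 < dotp x x by rewrite lt_neqAle eq_sym xx0 dotp_ge0.
by have : 0 < dotp y x; nra.
Qed.

Lemma enorm_scale t y : 0 <= t -> enorm (scalep t y) = t * enorm y.
Proof.
move=> t0; apply/eqP; rewrite -(eqrXn2 (n:=2))//; last 2 first.
- exact: enorm_ge0.
- by rewrite mulr_ge0 ?enorm_ge0.
rewrite exprMn !enorm_sqr dotp_scale.
by rewrite [dotp y _]dotpC dotp_scale mulrA.
Qed.

Lemma separable_outside_diam_balls x (M : set (point R d)) :
  (forall y, M y -> ~ diam_ball y x) -> linearly_separable x M.
Proof.
move=> Mx; exists x => y My; rewrite ltNge; apply/negP => yx.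
by apply: (Mx y My); rewrite /diam_ball /= dotpC.
Qed.

Lemma measurable_dotp y : measurable_fun setT (dotp y : point R d -> R).
Proof.
apply: measurable_sum => i; apply: measurable_funM => //.
exact: measurable_tnth.
Qed.

Lemma measurable_dotp_self : measurable_fun setT (fun x : point R d => dotp x x).
Proof.
by apply: measurable_sum => i; apply: measurable_funM; exact: measurable_tnth.
Qed.

Lemma measurable_diam_ball y : measurable (diam_ball y).
Proof.
rewrite -[X in measurable X]setTI; apply: measurable_fun_le => //.
  exact: measurable_dotp_self.
exact: measurable_dotp.
Qed.

Lemma measurable_eball r : measurable (eball r : set (point R d)).
Proof.
have [r0|r0] := leP 0 r.
  rewrite eballE// -[X in measurable X]setTI.
  by apply: measurable_fun_le => //; exact: measurable_dotp_self.
rewrite (_ : eball r = set0)// -subset0 => x; rewrite /eball /=.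
by move=> /le_lt_trans/(_ r0); rewrite ltNge enorm_ge0.
Qed.

Lemma measurable_layer r : measurable (layer r : set (point R d)).
Proof. by apply: measurableD; exact: measurable_eball. Qed.

(** The unit ball lies in the cube [[-1, 1]^d]. *)
Lemma lebesgue_eball_lty : (lebesgue_Rd (eball 1%R : set (point R d)) < +oo)%E.
Proof.
apply: (@le_lt_trans _ _ ((lebesgue_measure `[(-1)%R, 1%R]%classic) ^+ d)%E).
  rewrite -(@tuple_measure_all_in R _ _ (@lebesgue_measure R))//.
  apply: le_lebesgue_Rd => x; rewrite eballE//= expr1n => xx i.
  have xi : tnth x i ^+ 2 <= 1.
    apply: le_trans xx; rewrite /dotp (bigD1 i)//= -expr2 lerDl.
    by apply: sumr_ge0 => j _; rewrite -expr2 sqr_ge0.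
  rewrite in_itv /= -ler_norml -(@ler_pXn2r _ 2) ?nnegrE// expr1n.
  by rewrite real_normK ?num_real.
rewrite lebesgue_measure_itv/= lte_fin; case: ifP => _.
  by rewrite -EFinD -EFin_expe ltry.
by rewrite -EFin_expe ltry.
Qed.

Lemma lebesgue_eball_gt0 : (0 < lebesgue_Rd (eball 1%R : set (point R d)))%E.
Proof.
(* The cube [[-e, e]^d] fits in the unit ball: each squared coordinate is at most [e^2 <= e], and
   [d e <= 1]. The successor keeps [e] positive also for [d = 0]. *)
pose e : R := (d.+1%:R)^-1.
have e0 : 0 < e by rewrite invr_gt0.
apply: (@lt_le_trans _ _ ((lebesgue_measure `[(- e)%R, e]%classic) ^+ d)%E).
  rewrite lebesgue_measure_itv/= lte_fin gtrN// -EFinD -EFin_expe lte_fin.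
  by rewrite exprn_gt0// opprK addr_gt0.
rewrite -(@tuple_measure_all_in R _ _ (@lebesgue_measure R))//.
apply: le_lebesgue_Rd => x /= xe; rewrite eballE//= expr1n.
have xie i : tnth x i * tnth x i <= e.
  have := xe i; rewrite in_itv/= => /andP[? ?].
  have e1 : e <= 1 by rewrite invf_le1// ler1n.
  by nra.
apply: (@le_trans _ _ (\sum_(i < d) e)); first exact: ler_sum.
rewrite sumr_const card_ord -mulr_natl ler_pdivrMr// mul1r ler_nat.
exact: leqnSn.
Qed.

End diameter_balls.

(** * Volumes of balls, diameter balls and the layer *)

Section volumes.
Context {R : realType} {d : nat}.
Implicit Types (x y z : point R d) (r s t : R).

(** The ball of radius 0 lies in the [d]-th power of the null set [{0}]; for [d = 0] that power
    would have mass 1. *)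
Lemma lebesgue_eball0 : (0 < d)%N -> lebesgue_Rd (eball 0 : set (point R d)) = 0%E.
Proof.
move=> d0; apply/eqP; rewrite eq_le measure_ge0 andbT.
have -> : 0%E = (lebesgue_measure [set 0%R : R] ^+ d)%E :> \bar R.
  by rewrite lebesgue_measure_set1 -EFin_expe expr0n eqn0Ngt d0.
rewrite -(@tuple_measure_all_in R _ _ (@lebesgue_measure R))//.
apply: le_lebesgue_Rd => x; rewrite eballE//= expr0n/= => xx0 i.
by apply: dotp_eq0; apply/eqP; rewrite eq_le xx0 dotp_ge0.
Qed.

Definition ball_volume : R := fine (lebesgue_Rd (eball 1 : set (point R d))).

Lemma ball_volumeE : lebesgue_Rd (eball 1 : set (point R d)) = ball_volume%:E.
Proof.
by rewrite fineK// ge0_fin_numE ?measure_ge0//; exact: lebesgue_eball_lty.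
Qed.

Lemma ball_volume_gt0 : 0 < ball_volume.
Proof. by rewrite -lte_fin -ball_volumeE; exact: lebesgue_eball_gt0. Qed.

(** Scaling by [r^-1] carries the ball to the unit ball; radius 0 admits no such scaling and is the
    null case. *)
Lemma lebesgue_eball r : (0 < d)%N -> 0 <= r ->
  lebesgue_Rd (eball r : set (point R d)) = (r ^+ d * ball_volume)%:E.
Proof.
move=> d0; rewrite le_eqVlt => /predU1P[<-|r0].
  by rewrite lebesgue_eball0// expr0n eqn0Ngt d0 mul0r.
pose o : point R d := [tuple 0 | i < d].
have -> : eball r = [set x : point R d |
    eball 1 [tuple r^-1 * tnth x i - tnth o i | i < d]].
  have oo z : dotp o z = 0.
    by rewrite /dotp big1// => i _; rewrite tnth_mktuple mul0r.
  rewrite (eballE (ltW r0)) (eballE ler01) expr1n; apply/seteqP.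
  by split=> x; rewrite /= dotp_affine !oo mulr0 subr0 addr0 exprVn mulrC
    ler_pdivrMr ?mul1r ?exprn_gt0.
rewrite (lebesgue_Rd_affine (tnth o)) ?invr_gt0//; last exact: measurable_eball.
by rewrite invrK ball_volumeE EFinM.
Qed.

Lemma lebesgue_diam_ball y : (0 < d)%N ->
  lebesgue_Rd (diam_ball y) = ((enorm y / 2) ^+ d * ball_volume)%:E.
Proof.
move=> d0; have := enorm_ge0 y; rewrite le_eqVlt => /predU1P[y0|y0].
  rewrite -y0 mul0r expr0n eqn0Ngt d0 mul0r.
  apply/eqP; rewrite eq_le measure_ge0 andbT -[0%:E]/(0%E) -(lebesgue_eball0 d0) y0.
  by apply: le_lebesgue_Rd; exact: diam_ball_sub_eball.
have ny : enorm y != 0 by rewrite gt_eqF.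
(* This is [(2x - y) / |y|], which carries the ball with centre [y / 2] and radius [|y| / 2] onto
   the unit ball. *)
pose f (x : point R d) : point R d :=
  [tuple 2 / enorm y * tnth x i - tnth (scalep (enorm y)^-1 y) i | i < d].
have -> : diam_ball y = [set x : point R d | eball 1 (f x)].
  have fE x : dotp (f x) (f x) = (2 / enorm y) ^+ 2 * (dotp x x - dotp y x) + 1.
    rewrite dotp_affine -(enorm_sqr (scalep _ _)) enorm_scale ?invr_ge0 ?ltW//.
    by rewrite mulVf// expr1n dotp_scale; field.
  have c0 : 0 < (2 / enorm y) ^+ 2 by rewrite exprn_gt0// divr_gt0.
  apply/seteqP; split=> x; rewrite eballE//= expr1n fE gerDr /diam_ball/=;
    by rewrite pmulr_rle0// subr_le0.
rewrite (lebesgue_Rd_affine (tnth (scalep (enorm y)^-1 y))) ?divr_gt0//; last first.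
  exact: measurable_eball.
by rewrite invf_div ball_volumeE EFinM.
Qed.

Lemma lebesgue_layer r : (0 < d)%N -> 0 <= r <= 1 ->
  lebesgue_Rd (layer r : set (point R d)) = ((1 - r ^+ d) * ball_volume)%:E.
Proof.
move=> d0 /andP[r0 r1].
rewrite measureD/=; [|exact: measurable_eball..|exact: lebesgue_eball_lty].
rewrite setIC setIidl; last exact: subset_eball.
by rewrite !lebesgue_eball// expr1n mul1r -EFinB mulrBl mul1r.
Qed.

Lemma lebesgue_diam_ballD y r : (0 < d)%N -> 0 <= r <= 1 -> enorm y <= 1 ->
  (lebesgue_Rd (diam_ball y `\` eball r) <=
   (2 ^- d)%:E * lebesgue_Rd (layer r : set (point R d)))%E.
Proof.
move=> d0 /andP[r0 r1] y1; have [yr|ry] := leP (enorm y) r.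
  rewrite (_ : _ `\` _ = set0) ?measure0; last first.
    by rewrite -subset0 => x [/diam_ball_sub_eball/(subset_eball yr)].
  by rewrite mule_ge0// lee_fin invr_ge0 exprn_ge0.
have y0 : 0 < enorm y by exact: le_lt_trans ry.
pose t := r / enorm y; pose z := scalep t y.
have t01 : 0 <= t <= 1.
  by rewrite /t divr_ge0 ?enorm_ge0//= ler_pdivrMr// mul1r ltW.
have zr : enorm z = r.
  by rewrite enorm_scale ?(andP t01).1// /t divfK// gt_eqF.
apply: (@le_trans _ _ (lebesgue_Rd (diam_ball y `\` diam_ball z))).
  apply: le_lebesgue_Rd; apply: setDS.
  by rewrite -zr; exact: diam_ball_sub_eball.
rewrite measureD/=; [|exact: measurable_diam_ball..|]; last first.
  by rewrite lebesgue_diam_ball// ltry.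
rewrite setIC setIidl; last exact: diam_ball_scale.
rewrite !lebesgue_diam_ball// zr lebesgue_layer ?r0//.
(* Once the unit volume and [2^-d] are cancelled, [|y|^d - r^d <= 1 - r^d] remains. *)
rewrite -EFinB -EFinM lee_fin -mulrBl mulrA ler_wpM2r ?(ltW ball_volume_gt0)//.
rewrite !expr_div_n -mulrBl mulrC ler_wpM2l ?invr_ge0 ?exprn_ge0//.
by rewrite lerD2r exprn_ile1// ltW.
Qed.

End volumes.

(** * The uniform distribution on the layer *)

Section layer_uniform_theory.
Context {R : realType} {d : nat}.
Variable r : R.
Implicit Types (x y : point R d).

(** The layer has finite volume for every [r], as a part of the unit ball, so this is a nonnegative
    multiple of a finite restriction of Lebesgue measure. *)
Lemma layer_uniform_is_measure :
  exists m : {sigma_finite_measure set (point R d) -> \bar R},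
    layer_uniform r = m.
Proof.
have layer_lty : (lebesgue_Rd (layer r : set (point R d)) < +oo)%E.
  apply: le_lt_trans lebesgue_eball_lty; apply: le_lebesgue_Rd.
  exact: subDsetl.
have k0 : 0 <= (fine (lebesgue_Rd (layer r : set (point R d))))^-1.
  by rewrite invr_ge0 fine_ge0.
exists (mscale (NngNum k0) (mfrestr (measurable_layer r) layer_lty)).
by apply/funext => A; rewrite /layer_uniform muleC.
Qed.

Let layer_uniform0 : @layer_uniform R d r set0 = 0%E.
Proof. by have [m ->] := layer_uniform_is_measure. Qed.

Let layer_uniform_ge0 A : (0 <= @layer_uniform R d r A)%E.
Proof. by have [m ->] := layer_uniform_is_measure. Qed.

Let layer_uniform_sigma_additive : semi_sigma_additive (@layer_uniform R d r).
Proof.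
by have [m ->] := layer_uniform_is_measure; exact: measure_semi_sigma_additive.
Qed.

HB.instance Definition _ := isMeasure.Build _ _ _ (@layer_uniform R d r)
  layer_uniform0 layer_uniform_ge0 layer_uniform_sigma_additive.

Let sigma_finite_layer_uniform : sigma_finite setT (@layer_uniform R d r).
Proof. by have [m ->] := layer_uniform_is_measure; exact: sigma_finiteT. Qed.

HB.instance Definition _ := Measure_isSigmaFinite.Build _ _ _
  (@layer_uniform R d r) sigma_finite_layer_uniform.

(** Stated for all sets because it is applied to the set of separable points, whose measurability is
    not established. *)
Lemma le_layer_uniform :
  {homo (@layer_uniform R d r) : A B / A `<=` B >-> (A <= B)%E}.
Proof.
move=> A B AB; apply: lee_wpmul2r; first by rewrite lee_fin invr_ge0 fine_ge0.
by apply: le_lebesgue_Rd; exact: setSI.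
Qed.

Hypotheses (d_gt0 : (0 < d)%N) (r_ge0 : 0 <= r) (r_lt1 : r < 1).

Let layer_volume : R := fine (lebesgue_Rd (layer r : set (point R d))).

Let layer_volumeE : lebesgue_Rd (layer r : set (point R d)) = layer_volume%:E.
Proof. by rewrite /layer_volume lebesgue_layer// r_ge0 ltW. Qed.

Let layer_volume_gt0 : 0 < layer_volume.
Proof.
rewrite /layer_volume lebesgue_layer ?r_ge0 ?ltW//= mulr_gt0 ?ball_volume_gt0//.
by rewrite subr_gt0 exprn_ilt1// -lt0n.
Qed.

Lemma layer_uniform_eball1 : layer_uniform r (eball 1 : set (point R d)) = 1%E.
Proof.
rewrite /layer_uniform setIC setIidl; last exact: subDsetl.
by rewrite -/layer_volume layer_volumeE -EFinM mulfV// gt_eqF.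
Qed.

Lemma layer_uniformT : layer_uniform r [set: point R d] = 1%E.
Proof.
rewrite /layer_uniform setTI.
by rewrite -/layer_volume layer_volumeE -EFinM mulfV// gt_eqF.
Qed.

Lemma layer_uniform_diam_ball y : enorm y <= 1 ->
  (layer_uniform r (diam_ball y) <= (2 ^- d)%:E)%E.
Proof.
move=> y1; have r01 : 0 <= r <= 1 by rewrite r_ge0 ltW.
rewrite /layer_uniform -/layer_volume lee_pdivrMr// -layer_volumeE.
apply: le_trans (lebesgue_diam_ballD d_gt0 r01 y1).
by apply: le_lebesgue_Rd => x [yx [_ xr]].
Qed.

Lemma layer_uniform_separable n (s : n.-tuple (point R d)) :
  (forall i, enorm (tnth s i) <= 1) ->
  ((1 - n%:R / 2 ^+ d)%:E <= layer_uniform r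
    [set x | linearly_separable x [set tnth s i | i in [set: 'I_n]]])%E.
Proof.
move=> s1; pose U := \big[setU/set0]_(i < n) diam_ball (tnth s i).
(* The union bound; measurability is carried along for subadditivity at each step. *)
have [mU muU] : measurable U /\ (layer_uniform r U <= (n%:R / 2 ^+ d)%:E)%E.
  have -> : (n%:R / 2 ^+ d)%:E = (\sum_(i < n) (2 ^- d)%:E)%E :> \bar R.
    by rewrite sumEFin sumr_const card_ord mulr_natl.
  rewrite /U; apply: (big_ind2 (fun A a =>
    measurable A /\ (layer_uniform r A <= a)%E)).
  - by rewrite measure0.
  - move=> A a B b [mA Aa] [mB Bb]; split; first exact: measurableU.
    by apply: le_trans (leeD Aa Bb); exact: measureU2.
  - move=> i _; split; first exact: measurable_diam_ball.
    by apply: layer_uniform_diam_ball.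
apply: (@le_trans _ _ (layer_uniform r (~` U))); last first.
  apply: le_layer_uniform => x Ux; apply: separable_outside_diam_balls.
  move=> _ [i _ <-] six; apply: Ux; rewrite /U -bigcup_seq.
  by exists i => //=; rewrite mem_index_enum.
(* The total mass 1 is split between [U] and its complement. *)
rewrite EFinB leeBlDr// -layer_uniformT -(setvU U).
rewrite measureU ?setICl//; last exact: measurableC.
by rewrite leeD2l.
Qed.

End layer_uniform_theory.

(** * Averaging the conditional bound over the samples *)

Theorem corollary1 (R : realType) (r theta : R) (d n : nat)
    (hr0 : 0 <= r) (hr1 : r < 1) (htheta0 : 0 < theta) (htheta1 : theta < 1)
    (hd : (1 <= d)%N) (hn : (1 <= n)%N)
    (hnd : n%:R < theta * 2 ^+ d) :
  ((1 - theta)%:E < P1 d r n)%E.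
Proof.
have nd : n%:R / 2 ^+ d < theta by rewrite ltr_pdivrMr// exprn_gt0.
apply: (@lt_le_trans _ _ (1 - n%:R / 2 ^+ d)%:E).
  by rewrite lte_fin ltrD2l ltrN2.
pose mu : {sigma_finite_measure set (point R d) -> \bar R} := @layer_uniform R d r.
(* The samples to which [layer_uniform_separable] applies; they have full measure. *)
pose S := [set s : n.-tuple (point R d) | forall i, eball 1 (tnth s i)].
have mS : measurable S by apply: measurable_all_in; exact: measurable_eball.
have muS : tuple_measure mu n S = 1%E.
  rewrite tuple_measure_all_in; last exact: measurable_eball.
  by rewrite [mu _]layer_uniform_eball1// -EFin_expe expr1n.
have p0 : 0 <= 1 - n%:R / 2 ^+ d :> R by rewrite subr_ge0 ltW// (lt_trans nd).
(* The bound becomes the integral of [1 - n / 2^d] times the indicator of [S]. It is compared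
   pointwise with the slice measures whose integral is [P1]: the conditional bound on [S], zero
   elsewhere. *)
rewrite -[leLHS]mule1 -muS -[S]setIT -integral_indic//.
rewrite -ge0_integralZl//; last exact/measurable_EFinP.
apply: ge0_le_integralT => s; first by rewrite mule_ge0 ?lee_fin.
rewrite indicE; have [/set_mem sS|_] := boolP (s \in S); last by rewrite mule0.
rewrite mule1 /= xsectionE; exact: layer_uniform_separable.
Qed.
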